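(* Let $n\ge1$, let $\iota_n=ii\cdots i\in\Delta_n$ be the uniform $i$-word, $I_n=\sum_{w\in\{i,e\}^n}w$, and $$C_n^-=\Sigma_-(\iota_n),\qquad C_n^+=\Sigma_+(\iota_n),\qquad C_n^b=\Sigma_{\mathrm{tiles}}(\iota_n).$$ All four elements $I_n,C_n^-,C_n^+,C_n^b$ of $\mathcal A_n$ are symmetric with respect to the $I$-axis. Moreover \begin{align*} C_n^-I_n&=2^{n-1}\bigl(E_{ij}^{(n)}-E_{ek}^{(n)}\bigr), & I_nC_n^-&=2^{n-1}\bigl(E_{ik}^{(n)}-E_{ej}^{(n)}\bigr),\\ C_n^+I_n&=2^{n-1}\bigl(E_{ij}^{(n)}+E_{ek}^{(n)}\bigr), & I_nC_n^+&=2^{n-1}\bigl(E_{ik}^{(n)}+E_{ej}^{(n)}\bigr),\\ C_n^bI_n&=2^{n}E_{ij}^{(n)}, & I_nC_n^b&=2^nE_{ik}^{(n)}. \end{align*} The triangular axes among $I,J,K$ with respect to which the products are symmetric are exactly the following. \begin{itemize} \item $n=1$: each of $C_1^-I_1$, $C_1^+I_1$, $C_1^bI_1$ is symmetric about the $I$-axis only. \item $n=2$: $C_2^-I_2$ and $C_2^bI_2$ are symmetric about the $K$-axis only, while $C_2^+I_2$ is symmetric about all three axes $I,J,K$. \item $n\ge4$ even: each of $C_n^-I_n$, $C_n^+I_n$, $C_n^bI_n$ is symmetric about the $K$-axis only. \item $n\ge3$ odd: none of $C_n^-I_n$, $C_n^+I_n$, $C_n^bI_n$ is symmetric about any of the three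 axes. \end{itemize} For the reverse products $I_nC_n^-$, $I_nC_n^+$, $I_nC_n^b$ the same description holds with each entry ''$K$-axis only'' replaced by ''$J$-axis only''.
   Context: $\Delta_n=\{1,2,4,7\}^n$ is the set of words of length $n$. Digits are identified with quaternionic symbols: $1=i$, $2=j$, $4=k$, $7=e$, where $e$ is the identity, $i^2=j^2=k^2=-e$, $ij=k=-ji$, $jk=i=-kj$, $ki=j=-ik$. Words are multiplied coordinate by coordinate, with the local quaternionic signs collected into one global sign, so that products lie in $\Delta_n\sqcup(-\Delta_n)$. $\mathcal A_n$ is the real algebra with basis $\Delta_n$ and product extended bilinearly (so $\mathcal A_n\cong\mathbb H^{\otimes n}$). For $b\in\Delta_n$, $C_{+}(b)=\{c\in\Delta_n:cb=bc\text{ and }cb\in\Delta_n\}$, $C_{-}(b)=\{c\in\Delta_n:cb=bc\text{ and }cb\in-\Delta_n\}$, $C_{\mathrm{tiles}}(b)=C_+(b)\sqcup C_-(b)=\{c\in\Delta_n:cb=bc\}$, and $\Sigma_{+}(b)$, $\Sigma_{-}(b)$, $\Sigma_{\mathrm{tiles}}(b)$ are the sums in $\mathcal A_n$ of the words in $C_{+}(b)$, $C_{-}(b)$, $C_{\mathrm{tiles}}(b)$ respectively. For $a,b\in\{e,i,j,k\}$ put $E_{ab}^{(n)}=\sum w$, the sum over all $w\in\{a,b\}^n$ such that $\#\{r:w_r=b\}$ is even. The $I$-axis (resp. $J$-axis, $K$-axis) reflection is the linear map on $\mathcal A_n$ induced by applying in every coordinate the transposition of $\{i,j,k\}$ that fixes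 $i$ (resp. $j$, $k$), swaps the other two, and fixes $e$. An element $X\in\mathcal A_n$ is symmetric with respect to an axis if it is fixed by the corresponding reflection (coefficientwise equality). *)

(* Defs.v *)
From HB Require Import structures.
From mathcomp Require Import all_boot all_order all_fingroup all_algebra.
From mathcomp Require Import reals.

Set Implicit Arguments.
Unset Strict Implicit.
Unset Printing Implicit Defensive.

Import Order.TTheory GRing.Theory Num.Theory.

Local Open Scope ring_scope.

(* The digits 1, 2, 4, 7 are [Di], [Dj], [Dk], [De]. *)
Inductive digit := Di | Dj | Dk | De.

Definition digit_code (d : digit) : bool * bool :=
  match d with
  | De => (false, false) | Di => (true, false)
  | Dj => (false, true)  | Dk => (true, true)
  end.

Definition digit_decode (c : bool * bool) : digit :=
  match c with
  | (false, false) => De | (true, false) => Di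
  | (false, true) => Dj  | (true, true) => Dk
  end.

Lemma digit_codeK : cancel digit_code digit_decode.
Proof. by case. Qed.

HB.instance Definition _ := Finite.copy digit (can_type digit_codeK).

(* A sign and a digit; the sign [true] stands for [-]. *)
Definition dmul (x y : digit) : bool * digit :=
  match x, y with
  | De, y => (false, y)
  | x, De => (false, x)
  | Di, Di | Dj, Dj | Dk, Dk => (true, De)
  | Di, Dj => (false, Dk) | Dj, Di => (true, Dk)
  | Dj, Dk => (false, Di) | Dk, Dj => (true, Di)
  | Dk, Di => (false, Dj) | Di, Dk => (true, Dj)
  end.

Notation word n := {ffun 'I_n -> digit}.

Definition wsign (n : nat) (u v : word n) : bool :=
  \big[addb/false]_(r < n) (dmul (u r) (v r)).1.

Definition wprod (n : nat) (u v : word n) : word n :=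
  [ffun r => (dmul (u r) (v r)).2].

(* The product of two words, an element of the disjoint union of the set of
   words and its opposite: [(false, w)] is [w] and [(true, w)] is [- w]. *)
Definition wmul (n : nat) (u v : word n) : bool * word n :=
  (wsign u v, wprod u v).

Definition cword (n : nat) (d : digit) : word n := [ffun=> d].

(* Coefficient functions on words.  The alias keeps the pointwise product of
   [{ffun _ -> R^o}] from being inferred as the ring structure. *)
Definition tilealg (R : realType) (n : nat) : Type := {ffun word n -> R^o}.

HB.instance Definition _ (R : realType) (n : nat) :=
  GRing.Lmodule.copy (tilealg R n) {ffun word n -> R^o}.

Definition tile (R : realType) (n : nat) (w : word n) : tilealg R n :=
  [ffun v => (v == w)%:R].

Definition stile (R : realType) (n : nat) (sw : bool * word n) : tilealg R n :=
  (-1) ^+ sw.1 *: tile R sw.2.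

Definition amul (R : realType) (n : nat) (X Y : tilealg R n) : tilealg R n :=
  \sum_(u : word n) \sum_(v : word n) ((X u : R) * (Y v : R)) *: stile R (wmul u v).

Section Algebra.
Variables (R : realType) (n : nat).
Implicit Types (u v w : word n) (X Y Z : tilealg R n) (a : R).

Lemma acoefZ a X w : (a *: X) w = a * (X w : R) :> R.
Proof. by rewrite ffunE. Qed.

Lemma tile_sum X : X = \sum_w X w *: tile R w.
Proof.
apply/ffunP => v; rewrite sum_ffunE (bigD1 v) //= big1 => [|w wv].
  by rewrite !ffunE eqxx addr0 [_ *: _]mulr1.
by rewrite !ffunE eq_sym (negPf wv) [_ *: _]mulr0.
Qed.

Lemma amulDl : left_distributive (@amul R n) +%R.
Proof.
move=> X Y Z; rewrite /amul -big_split; apply: eq_bigr => u _ /=.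
by rewrite -big_split; apply: eq_bigr => v _; rewrite ffunE mulrDl scalerDl.
Qed.

Lemma amulDr : right_distributive (@amul R n) +%R.
Proof.
move=> X Y Z; rewrite /amul -big_split; apply: eq_bigr => u _ /=.
by rewrite -big_split; apply: eq_bigr => v _; rewrite ffunE mulrDr scalerDl.
Qed.

Lemma amulZl a X Y : amul (a *: X) Y = a *: amul X Y.
Proof.
rewrite /amul scaler_sumr; apply: eq_bigr => u _; rewrite scaler_sumr.
by apply: eq_bigr => v _; rewrite acoefZ scalerA mulrA.
Qed.

Lemma amulZr a X Y : amul X (a *: Y) = a *: amul X Y.
Proof.
rewrite /amul scaler_sumr; apply: eq_bigr => u _; rewrite scaler_sumr.
by apply: eq_bigr => v _; rewrite acoefZ scalerA mulrCA.
Qed.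

Lemma tile_ind (P : tilealg R n -> Prop) :
    (forall w, P (tile R w)) -> (forall X Y, P X -> P Y -> P (X + Y)) ->
    (forall a X, P X -> P (a *: X)) -> forall X, P X.
Proof.
move=> Pt PD PZ X; rewrite [X]tile_sum; elim/big_ind: _ => // [|w _].
  by rewrite -(scale0r (tile R (cword n De))); apply: PZ.
exact: PZ.
Qed.

Lemma amul_tile u v : amul (tile R u) (tile R v) = stile R (wmul u v).
Proof.
rewrite /amul (bigD1 u) //= [X in _ + X]big1 ?addr0 => [|u' neu].
  rewrite (bigD1 v) //= big1 ?addr0 => [|v' nev].
    by rewrite !ffunE !eqxx mulr1 scale1r.
  by rewrite !ffunE (negPf nev) mulr0 scale0r.
by apply: big1 => v' _; rewrite !ffunE (negPf neu) mul0r scale0r.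
Qed.

Lemma wmulA u v w :
  (wsign u (wprod v w) (+) wsign v w = wsign u v (+) wsign (wprod u v) w)
  /\ wprod u (wprod v w) = wprod (wprod u v) w.
Proof.
split; last by apply/ffunP => r; rewrite !ffunE; case: (u r) (v r) (w r) => [] [] [].
rewrite /wsign -!big_split; apply: eq_bigr => r _ /=; rewrite !ffunE.
by case: (u r) (v r) (w r) => [] [] [].
Qed.

Lemma amul_tileA u v w :
  amul (tile R u) (amul (tile R v) (tile R w)) =
  amul (amul (tile R u) (tile R v)) (tile R w).
Proof.
have [Es Ew] := wmulA u v w.
rewrite !amul_tile /stile /= amulZr amulZl !amul_tile /stile /= !scalerA Ew.
by rewrite -!signr_addb [_ v w (+) _]addbC Es.
Qed.

Lemma amulA : associative (@amul R n).
Proof.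
elim/tile_ind => [u|X X' IH IH'|a X IH] Y Z.
- elim/tile_ind: Y => [v|Y Y' IH IH'|a Y IH].
  + elim/tile_ind: Z => [w|Z Z' IH IH'|a Z IH]; first exact: amul_tileA.
      by rewrite !amulDr IH IH'.
    by rewrite !amulZr IH.
  + by rewrite amulDl !amulDr amulDl IH IH'.
  + by rewrite amulZl !amulZr amulZl IH.
- by rewrite !amulDl IH IH'.
- by rewrite !amulZl IH.
Qed.

Lemma amul1l : left_id (tile R (cword n De)) (@amul R n).
Proof.
elim/tile_ind => [w|X Y IHX IHY|a X IH]; first last.
- by rewrite amulZr IH.
- by rewrite amulDr IHX IHY.
rewrite amul_tile /stile /= /wsign big1 ?scale1r => [|r _]; last by rewrite ffunE.
by congr tile; apply/ffunP => r; rewrite !ffunE.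
Qed.

Lemma amul1r : right_id (tile R (cword n De)) (@amul R n).
Proof.
elim/tile_ind => [w|X Y IHX IHY|a X IH]; first last.
- by rewrite amulZl IH.
- by rewrite amulDl IHX IHY.
rewrite amul_tile /stile /= /wsign big1 ?scale1r => [|r _].
  by congr tile; apply/ffunP => r; rewrite !ffunE; case: ((w : word n) r).
by rewrite ffunE; case: ((w : word n) r).
Qed.

Lemma tile_neq0 w : tile R w != 0.
Proof. by apply/eqP => /ffunP/(_ w)/eqP; rewrite !ffunE eqxx oner_eq0. Qed.

HB.instance Definition _ := GRing.Zmodule_isNzRing.Build (tilealg R n)
  amulA amul1l amul1r amulDl amulDr (tile_neq0 (cword n De)).

HB.instance Definition _ := GRing.Lmodule_isLalgebra.Build R (tilealg R n)
  (fun a X Y => esym (amulZl a X Y)).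

HB.instance Definition _ := GRing.Lalgebra_isAlgebra.Build R (tilealg R n)
  (fun a X Y => esym (amulZr a X Y)).

End Algebra.

Definition Cplus (n : nat) (b : word n) : {set word n} :=
  [set c | (wmul c b == wmul b c) && ~~ (wmul c b).1].

Definition Cminus (n : nat) (b : word n) : {set word n} :=
  [set c | (wmul c b == wmul b c) && (wmul c b).1].

Definition Ctiles (n : nat) (b : word n) : {set word n} :=
  Cplus b :|: Cminus b.

Definition Sigma_plus (R : realType) (n : nat) (b : word n) : tilealg R n :=
  \sum_(c in Cplus b) tile R c.

Definition Sigma_minus (R : realType) (n : nat) (b : word n) : tilealg R n :=
  \sum_(c in Cminus b) tile R c.

Definition Sigma_tiles (R : realType) (n : nat) (b : word n) : tilealg R n :=
  \sum_(c in Ctiles b) tile R c.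

(* The set of words all of whose digits are [a] or [b]. *)
Definition words2 (n : nat) (a b : digit) : {set word n} :=
  [set w : word n | [forall r, (w r == a) || (w r == b)]].

Definition Eab (R : realType) (n : nat) (a b : digit) : tilealg R n :=
  \sum_(w in words2 n a b | ~~ odd #|[set r | w r == b]|) tile R w.

Definition Isum (R : realType) (n : nat) : tilealg R n :=
  \sum_(w in words2 n Di De) tile R w.

Inductive axis := axI | axJ | axK.

Definition axis_code (x : axis) : option bool :=
  match x with axI => None | axJ => Some false | axK => Some true end.

Definition axis_decode (c : option bool) : axis :=
  match c with None => axI | Some false => axJ | Some true => axK end.

Lemma axis_codeK : cancel axis_code axis_decode.
Proof. by case. Qed.

HB.instance Definition _ := Finite.copy axis (can_type axis_codeK).

Definition axis_tperm (x : axis) : {perm digit} :=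
  match x with
  | axI => tperm Dj Dk | axJ => tperm Di Dk | axK => tperm Di Dj
  end.

Definition wreflect (n : nat) (x : axis) (w : word n) : word n :=
  [ffun r => axis_tperm x (w r)].

Definition reflect_axis (R : realType) (n : nat) (x : axis) (X : tilealg R n) :
    tilealg R n :=
  \sum_(w : word n) X w *: tile R (wreflect x w).

Lemma reflect_axis_is_linear (R : realType) (n : nat) (x : axis) :
  linear (@reflect_axis R n x).
Proof.
move=> a X Y; rewrite /reflect_axis scaler_sumr -big_split.
by apply: eq_bigr => w _; rewrite ffunE scalerDl acoefZ scalerA.
Qed.

Lemma reflect_axis_tile (R : realType) (n : nat) (x : axis) (w : word n) :
  reflect_axis x (tile R w) = tile R (wreflect x w).
Proof.
rewrite /reflect_axis (bigD1 w) //= big1 => [|v vw]; rewrite ffunE.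
  by rewrite eqxx scale1r addr0.
by rewrite (negPf vw) scale0r.
Qed.

Definition symmetric_about (R : realType) (n : nat) (x : axis)
    (X : tilealg R n) : bool :=
  reflect_axis x X == X.

Definition sym_axes (R : realType) (n : nat) (X : tilealg R n) : {set axis} :=
  [set x | symmetric_about x X].

(* Main.v *)
From HB Require Import structures.
Require Import Defs.
From mathcomp Require Import all_boot all_order all_fingroup all_algebra.
From mathcomp Require Import reals ring.

(**
  An element of H^(tensor n) whose coefficient at a word w is the product of
  f (w_r) is the pure tensor f (x) ... (x) f, and pure tensors multiply digit
  by digit in H.  Splitting parity conditions with (1 + (-1)^m) / 2 gives
    2 C^b         = (e + i + j + k)^(x)n + (e + i - j - k)^(x)n,
    2 (C^+ - C^-) = (e - i - j + k)^(x)n + (e - i + j - k)^(x)n,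
    2 E_ab        = (a + b)^(x)n + (a - b)^(x)n,     I_n = (e + i)^(x)n,
  so the products C I reduce to four products of quaternions.  A reflection is
  an anti-automorphism of the algebra, and the one about the I-axis fixes I_n
  and the three C's; it therefore exchanges C I with I C, and the J-axis with
  the K-axis.  All products C I are multiples of E_ij + c E_ek with
  c = 1, -1, 0; the missing symmetries are excluded by comparing coefficients
  at a uniform word or at jji...i.
*)

Import Order.TTheory GRing.Theory Num.Theory.
Local Open Scope ring_scope.

(** * Pure tensors and the quaternion product of their factors *)

Lemma big_digit (R : nmodType) (F : digit -> R) :
  \sum_d F d = F De + F Di + F Dj + F Dk.
Proof.
rewrite (bigD1 De) //= (bigD1 Di) //= (bigD1 Dj) //= (bigD1 Dk) //=.
by rewrite big1 ?addr0 ?addrA // => -[].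
Qed.

Definition qtensor {R : realType} {n : nat} (f : digit -> R) : tilealg R n :=
  [ffun w : word n => \prod_(r < n) f (w r)].

(** The quaternion product, kept as a double sum of signs and indicators because distributing a
    product over positions needs this shape; [qmul_vec] gives Hamilton's closed formula. *)
Definition qmul {R : realType} (f g : digit -> R) (d : digit) : R :=
  \sum_a \sum_b f a * g b * ((-1) ^+ (dmul a b).1 * ((dmul a b).2 == d)%:R).

Lemma prod_signr (R : realType) (n : nat) (F : 'I_n -> bool) :
  \prod_(r < n) (-1) ^+ F r = (-1) ^+ (\big[addb/false]_(r < n) F r) :> R.
Proof.
apply: esym; apply: (big_morph (fun b : bool => (-1) ^+ b : R)) => //.
exact: signr_addb.
Qed.

Lemma prod_natb (R : realType) (n : nat) (F : 'I_n -> bool) :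
  \prod_(r < n) (F r)%:R = [forall r, F r]%:R :> R.
Proof.
have [/forallP Ft|/forallPn[r /negPf Fr]] := boolP [forall r, F r].
  by rewrite big1 // => r _; rewrite Ft.
by rewrite (bigD1 r) //= Fr mul0r.
Qed.

(** Distributing the product over positions turns choices of digits into pairs of words [u], [v].
    The local signs multiply to [wsign u v], and the local indicators to the indicator of
    [wprod u v = w]. *)
Lemma qtensorM (R : realType) (n : nat) (f g : digit -> R) :
  qtensor f * qtensor g = qtensor (qmul f g) :> tilealg R n.
Proof.
apply/ffunP => w; rewrite [RHS]ffunE bigA_distr_bigA sum_ffunE.
apply: eq_bigr => u _; rewrite bigA_distr_bigA sum_ffunE.
apply: eq_bigr => v _; rewrite !big_split /= prod_signr prod_natb !ffunE /=.
rewrite eq_sym [in LHS]/GRing.scale /=.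
congr (_ * (_ * _%:R)); congr nat_of_bool.
apply/eqP/forallP => [<- r|/(_ _)/eqP E]; first by rewrite !ffunE.
by apply/ffunP => r; rewrite ffunE E.
Qed.

Lemma eq_qtensor (R : realType) (n : nat) (f g : digit -> R) :
  f =1 g -> qtensor f = qtensor g :> tilealg R n.
Proof. by move=> fg; apply/ffunP => w; rewrite !ffunE; apply: eq_bigr. Qed.

Lemma qtensorZ (R : realType) (n : nat) (c : R) (f : digit -> R) :
  qtensor (fun d => c * f d) = c ^+ n *: qtensor f :> tilealg R n.
Proof.
by apply/ffunP => w; rewrite !ffunE big_split prodr_const card_ord.
Qed.

(** Coordinates come in the order e, i, j, k, unlike the constructors of [digit]. *)
Definition qvec {R : realType} (e i j k : R) (d : digit) : R :=
  match d with De => e | Di => i | Dj => j | Dk => k end.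

Lemma qmul_vec (R : realType) (e i j k e' i' j' k' : R) :
  qmul (qvec e i j k) (qvec e' i' j' k') =1
  qvec (e * e' - i * i' - j * j' - k * k') (e * i' + i * e' + j * k' - k * j')
       (e * j' + j * e' + k * i' - i * k') (e * k' + k * e' + i * j' - j * i').
Proof.
by case; rewrite /qmul !big_digit /=; ring.
Qed.

(** * Expressing [Eab], [Isum] and the commutant sums by pure tensors *)

Lemma sum_tile_coef (R : realType) (n : nat) (P : pred (word n)) (w : word n) :
  (\sum_(v | P v) tile R v) w = (P w)%:R :> R.
Proof.
rewrite sum_ffunE; have [Pw|nPw] := boolP (P w).
  rewrite (bigD1 w) //= big1 ?addr0 ?ffunE ?eqxx // => v /andP[_ vw].
  by rewrite ffunE eq_sym (negPf vw).
rewrite big1 // => v Pv; rewrite ffunE; case: eqP => // wv.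
by rewrite wv Pv in nPw.
Qed.

(** Parity is an iterated exclusive or, so that [prod_signr] turns it into a product of local
    signs. *)
Definition even_word2 {n : nat} (a b : digit) (w : word n) : bool :=
  [forall r, (w r == a) || (w r == b)]
  && ~~ \big[addb/false]_(r < n) (w r == b).

Lemma Eab_coef (R : realType) (n : nat) (a b : digit) (w : word n) :
  Eab R n a b w = (even_word2 a b w)%:R :> R.
Proof.
rewrite /Eab sum_tile_coef inE /even_word2; congr (_ && ~~ _)%:R.
rewrite -sum1dep_card big_mkcond (big_morph odd oddD (erefl _)).
by apply: eq_bigr => r _; case: eqP.
Qed.

Lemma Eab_tensor (R : realType) (n : nat) (a b : digit) : a != b ->
  2 *: Eab R n a b =
  qtensor (fun d => ((d == a) || (d == b))%:R) +
  qtensor (fun d => (d == a)%:R - (d == b)%:R).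
Proof.
move=> ab; apply/ffunP => w; rewrite !ffunE Eab_coef prod_natb.
(* Each factor is the indicator of the alphabet times a sign that is negative exactly at [b]; this
   uses [a != b]. *)
have -> : \prod_(r < n) ((w r == a)%:R - (w r == b)%:R) =
   \prod_(r < n) (((w r == a) || (w r == b))%:R * (-1) ^+ (w r == b)) :> R.
  apply: eq_bigr => r _; case: (w r =P a) => [->|_].
    by rewrite (negPf ab) /= subr0 mulr1.
  by case: eqP => _ /=; ring.
rewrite big_split /= prod_natb prod_signr /even_word2.
case: [forall r, _]; case: (\big[_/_]_(_ < n) _) => /=;
  rewrite /GRing.scale /=; ring.
Qed.

Lemma Isum_tensor (R : realType) (n : nat) : Isum R n = qtensor (qvec 1 1 0 0).
Proof.
apply/ffunP => w; rewrite /Isum sum_tile_coef !ffunE inE -prod_natb.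
by apply: eq_bigr => r _; case: (w r).
Qed.

(** Up to sign the product is commutative, and only j and k anticommute with i. The two signs thus
    differ by the parity of the number of digits j or k. *)
Lemma comm_iota (n : nat) (w : word n) :
  (wmul w (cword n Di) == wmul (cword n Di) w) =
  ~~ \big[addb/false]_(r < n) ((w r == Dj) || (w r == Dk)).
Proof.
rewrite /wmul xpair_eqE.
have -> : wprod w (cword n Di) = wprod (cword n Di) w.
  by apply/ffunP => r; rewrite !ffunE; case: (w r).
rewrite eqxx andbT.
have -> : \big[addb/false]_(r < n) ((w r == Dj) || (w r == Dk)) =
  wsign w (cword n Di) (+) wsign (cword n Di) w.
  rewrite /wsign -big_split; apply: eq_bigr => r _ /=.
  by rewrite ffunE; case: (w r).
by case: (wsign _ _); case: (wsign _ _).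
Qed.

Lemma Sigma_tilesE (R : realType) (n : nat) (b : word n) :
  Sigma_tiles R b = Sigma_plus R b + Sigma_minus R b.
Proof.
apply/ffunP => w; rewrite ffunE !sum_tile_coef !inE.
by case: (_ == _); case: (_.1); rewrite /= ?addr0 ?add0r.
Qed.

(** The second tensor has coefficient (-1)^m, where m counts the digits j and k; adding the constant
    1 selects even m. *)
Lemma Sigma_tiles_tensor (R : realType) (n : nat) :
  2 *: Sigma_tiles R (cword n Di) =
  qtensor (qvec 1 1 1 1) + qtensor (qvec 1 1 (-1) (-1)).
Proof.
apply/ffunP => w; rewrite !ffunE sum_tile_coef !inE -andb_orr orNb andbT.
rewrite comm_iota [X in _ = X + _]big1 => [|r _]; last by case: (w r).
have -> : \prod_(r < n) qvec 1 1 (-1) (-1) (w r) =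
   \prod_(r < n) (-1) ^+ ((w r == Dj) || (w r == Dk)) :> R.
  by apply: eq_bigr => r _; case: (w r).
rewrite prod_signr; case: (\big[_/_]_(_ < n) _);
  rewrite /= /GRing.scale /=; ring.
Qed.

(** Right multiplication by i has negative sign on i and j only, so the first tensor carries the
    sign of the product of [w] with the uniform i-word. The second carries it times the commutation
    sign. *)
Lemma Sigma_diff_tensor (R : realType) (n : nat) :
  2 *: (Sigma_plus R (cword n Di) - Sigma_minus R (cword n Di)) =
  qtensor (qvec 1 (-1) (-1) 1) + qtensor (qvec 1 (-1) 1 (-1)).
Proof.
apply/ffunP => w; rewrite !ffunE !sum_tile_coef !inE comm_iota.
have -> : \prod_(r < n) qvec 1 (-1) (-1) 1 (w r) =
   (-1) ^+ wsign w (cword n Di) :> R.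
  by rewrite -prod_signr; apply: eq_bigr => r _; rewrite ffunE; case: (w r).
have -> : \prod_(r < n) qvec 1 (-1) 1 (-1) (w r) =
   (-1) ^+ wsign w (cword n Di) *
   \prod_(r < n) (-1) ^+ ((w r == Dj) || (w r == Dk)) :> R.
  rewrite -prod_signr -big_split; apply: eq_bigr => r _.
  by rewrite ffunE; case: (w r); rewrite /= ?mulr1 ?mul1r ?mulrN1 ?opprK.
rewrite prod_signr /=; case: (\big[_/_]_(_ < n) _); case: (wsign _ _);
  rewrite /= /GRing.scale /=; ring.
Qed.

(** * The products with [Isum] on the right *)

Lemma scale2_inj (R : realType) (n : nat) (X Y : tilealg R n) :
  2 *: X = 2 *: Y -> X = Y.
Proof. by apply: scalerI; rewrite pnatr_eq0. Qed.

(** Right multiplication by e + i sends coordinates (e, i, j, k) to (e - i, e + i, j + k, k - j).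
    When these are written as doubles, each position contributes a factor 2. *)
Lemma tensor_mulI (R : realType) (n : nat) (e i j k e' i' j' k' : R) :
  e - i = 2 * e' -> e + i = 2 * i' -> j + k = 2 * j' -> k - j = 2 * k' ->
  qtensor (qvec e i j k) * Isum R n = 2 ^+ n *: qtensor (qvec e' i' j' k').
Proof.
move=> He Hi Hj Hk; rewrite Isum_tensor qtensorM -qtensorZ; apply: eq_qtensor.
move=> d; rewrite qmul_vec.
by case: d => /=; rewrite -?He -?Hi -?Hj -?Hk; ring.
Qed.

Lemma Sigma_tiles_mulI (R : realType) (n : nat) :
  Sigma_tiles R (cword n Di) * Isum R n = 2 ^+ n *: Eab R n Di Dj.
Proof.
apply: scale2_inj; rewrite scalerAl Sigma_tiles_tensor mulrDl.
(* (e + i + j + k)(e + i) = 2(i + j), and next (e + i - j - k)(e + i) = 2(i - j). *)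
rewrite (tensor_mulI _ _ _ _ _ _ 0 1 1 0); try ring.
rewrite (tensor_mulI _ _ _ _ _ _ 0 1 (-1) 0); try ring.
rewrite scalerA mulrC -scalerA Eab_tensor // -scalerDr.
by congr (_ *: (_ + _)); apply: eq_qtensor; case; rewrite /= ?subrr ?sub0r ?subr0.
Qed.

Lemma Sigma_diff_mulI (R : realType) (n : nat) :
  (Sigma_plus R (cword n Di) - Sigma_minus R (cword n Di)) * Isum R n =
  2 ^+ n *: Eab R n De Dk.
Proof.
apply: scale2_inj; rewrite scalerAl Sigma_diff_tensor mulrDl.
(* (e - i - j + k)(e + i) = 2(e + k), and next (e - i + j - k)(e + i) = 2(e - k). *)
rewrite (tensor_mulI _ _ _ _ _ _ 1 0 0 1); try ring.
rewrite (tensor_mulI _ _ _ _ _ _ 1 0 0 (-1)); try ring.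
rewrite scalerA mulrC -scalerA Eab_tensor // -scalerDr.
by congr (_ *: (_ + _)); apply: eq_qtensor; case; rewrite /= ?subrr ?sub0r ?subr0.
Qed.

(** Twice [Sigma_plus] is [Sigma_tiles] plus the difference of the signed sums; positivity of [n]
    lets 2 times [2 ^+ n.-1] be [2 ^+ n]. *)
Lemma Sigma_plus_mulI (R : realType) (n : nat) : (0 < n)%N ->
  Sigma_plus R (cword n Di) * Isum R n =
  2 ^+ n.-1 *: (Eab R n Di Dj + Eab R n De Dk).
Proof.
move=> n_gt0; apply: scale2_inj; rewrite scalerA -exprS prednK // scalerDr.
rewrite -Sigma_tiles_mulI -Sigma_diff_mulI -mulrDl Sigma_tilesE scalerAl.
by congr (_ * _); rewrite addrACA subrr addr0 scaler_nat mulr2n.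
Qed.

Lemma Sigma_minus_mulI (R : realType) (n : nat) : (0 < n)%N ->
  Sigma_minus R (cword n Di) * Isum R n =
  2 ^+ n.-1 *: (Eab R n Di Dj - Eab R n De Dk).
Proof.
move=> n_gt0; apply: scale2_inj; rewrite scalerA -exprS prednK // scalerBr.
rewrite -Sigma_tiles_mulI -Sigma_diff_mulI -mulrBl Sigma_tilesE scalerAl.
congr (_ * _); rewrite opprB [X in X + _]addrC addrACA subrr addr0.
by rewrite scaler_nat mulr2n.
Qed.

(** * Reflections: action on coefficients, on products and on the four elements *)

Definition axis_swap (x : axis) (d : digit) : digit :=
  match x, d with
  | axI, Dj => Dk | axI, Dk => Dj
  | axJ, Di => Dk | axJ, Dk => Di
  | axK, Di => Dj | axK, Dj => Di
  | _, d => d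
  end.

Lemma axis_tpermE (x : axis) : axis_tperm x =1 axis_swap x.
Proof. by case: x => -[]; rewrite /= ?tpermL ?tpermR ?tpermD. Qed.

Lemma axis_swapK (x : axis) : involutive (axis_swap x).
Proof. by case: x => -[]. Qed.

Lemma wreflectE (n : nat) (x : axis) (w : word n) (r : 'I_n) :
  wreflect x w r = axis_swap x (w r).
Proof. by rewrite ffunE axis_tpermE. Qed.

Lemma wreflectK (n : nat) (x : axis) : involutive (@wreflect n x).
Proof. by move=> w; apply/ffunP => r; rewrite !wreflectE axis_swapK. Qed.

Lemma reflect_axis_coef (R : realType) (n : nat) (x : axis) (X : tilealg R n)
  (w : word n) : reflect_axis x X w = X (wreflect x w).
Proof.
rewrite /reflect_axis sum_ffunE (bigD1 (wreflect x w)) //= big1 => [|v vw].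
  by rewrite !ffunE wreflectK eqxx addr0 [_ *: _]mulr1.
rewrite !ffunE; case: eqP => [wv|_]; last exact: mulr0.
by rewrite wv wreflectK eqxx in vw.
Qed.

Lemma symmetricP (R : realType) (n : nat) (x : axis) (X : tilealg R n) :
  reflect (forall w, X (wreflect x w) = X w) (symmetric_about x X).
Proof.
apply: (iffP eqP) => [E w|E]; first by rewrite -reflect_axis_coef E.
by apply/ffunP => w; rewrite reflect_axis_coef E.
Qed.

HB.instance Definition _ (R : realType) (n : nat) (x : axis) :=
  GRing.isLinear.Build R (tilealg R n) (tilealg R n) _ (reflect_axis x)
    (@reflect_axis_is_linear R n x).

(** A transposition of i, j, k reverses their cyclic order, hence reverses quaternion products.
    Bilinearity reduces the claim to tiles, where it is checked digit by digit. *)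
Lemma reflect_axisM (R : realType) (n : nat) (x : axis) (X Y : tilealg R n) :
  reflect_axis x (X * Y) = reflect_axis x Y * reflect_axis x X.
Proof.
elim/tile_ind: X => [u|X X' IH IH'|a X IH]; first last.
- by rewrite -scalerAl linearZ /= IH linearZ /= scalerAr.
- by rewrite mulrDl !linearD /= IH IH' mulrDr.
elim/tile_ind: Y => [v|Y Y' IH IH'|a Y IH]; first last.
- by rewrite -scalerAr linearZ /= IH linearZ /= scalerAl.
- by rewrite mulrDr !linearD /= IH IH' mulrDl.
rewrite !reflect_axis_tile [_ * _]amul_tile [RHS]amul_tile /stile linearZ /=.
rewrite reflect_axis_tile; congr (_ ^+ nat_of_bool _ *: tile R _).
  rewrite /wsign; apply: eq_bigr => r _; rewrite !wreflectE.
  by case: x (u r) (v r) => -[] [].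
apply/ffunP => r; rewrite wreflectE !ffunE !axis_tpermE.
by case: x (u r) (v r) => -[] [].
Qed.

Lemma reflect_axis_tensor (R : realType) (n : nat) (x : axis) (f : digit -> R) :
  reflect_axis x (qtensor f) = qtensor (f \o axis_swap x) :> tilealg R n.
Proof.
apply/ffunP => w; rewrite reflect_axis_coef !ffunE.
by apply: eq_bigr => r _; rewrite wreflectE.
Qed.

Lemma reflect_Eab (R : realType) (n : nat) (x : axis) (a b : digit) :
  reflect_axis x (Eab R n a b) = Eab R n (axis_swap x a) (axis_swap x b).
Proof.
apply/ffunP => w; rewrite reflect_axis_coef !Eab_coef; congr _%:R.
have E (d c : digit) : (axis_swap x d == c) = (d == axis_swap x c).
  exact: (can2_eq (axis_swapK x) (axis_swapK x)).
rewrite /even_word2; congr (nat_of_bool (_ && ~~ _)).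
  by apply: eq_forallb => r; rewrite wreflectE !E.
by apply: eq_bigr => r _; rewrite wreflectE E.
Qed.

Lemma reflect_Isum (R : realType) (n : nat) :
  reflect_axis axI (Isum R n) = Isum R n.
Proof.
by rewrite Isum_tensor reflect_axis_tensor; apply: eq_qtensor; case.
Qed.

Lemma reflect_Sigma_tiles (R : realType) (n : nat) :
  reflect_axis axI (Sigma_tiles R (cword n Di)) = Sigma_tiles R (cword n Di).
Proof.
apply: scale2_inj; rewrite -linearZ /= Sigma_tiles_tensor linearD /=.
by rewrite !reflect_axis_tensor; congr (_ + _); apply: eq_qtensor; case.
Qed.

Lemma reflect_Sigma_diff (R : realType) (n : nat) :
  let D := Sigma_plus R (cword n Di) - Sigma_minus R (cword n Di) in
  reflect_axis axI D = D.
Proof.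
move=> D; apply: scale2_inj; rewrite -linearZ /= Sigma_diff_tensor linearD /=.
(* Swapping j and k exchanges the two tensors, hence the commutation of the sum. *)
by rewrite !reflect_axis_tensor addrC; congr (_ + _); apply: eq_qtensor; case.
Qed.

Lemma reflect_Sigma_plus (R : realType) (n : nat) :
  reflect_axis axI (Sigma_plus R (cword n Di)) = Sigma_plus R (cword n Di).
Proof.
have E : 2 *: Sigma_plus R (cword n Di) = Sigma_tiles R (cword n Di)
    + (Sigma_plus R (cword n Di) - Sigma_minus R (cword n Di)).
  by rewrite Sigma_tilesE addrACA subrr addr0 scaler_nat mulr2n.
apply: scale2_inj; rewrite -linearZ /= E linearD /=.
by rewrite reflect_Sigma_tiles reflect_Sigma_diff.
Qed.

Lemma reflect_Sigma_minus (R : realType) (n : nat) :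
  reflect_axis axI (Sigma_minus R (cword n Di)) = Sigma_minus R (cword n Di).
Proof.
have E : Sigma_minus R (cword n Di) =
    Sigma_tiles R (cword n Di) - Sigma_plus R (cword n Di).
  by rewrite Sigma_tilesE addrC addKr.
by rewrite E linearB /= reflect_Sigma_tiles reflect_Sigma_plus.
Qed.

(** * Symmetry axes under scaling and under the I-reflection *)

Lemma sym_axesZ (R : realType) (n : nat) (c : R) (X : tilealg R n) :
  c != 0 -> sym_axes (c *: X) = sym_axes X.
Proof.
move=> c0; apply/setP => x; rewrite !inE /symmetric_about linearZ /=.
by apply/eqP/eqP => [/(scalerI c0)|->].
Qed.

Definition axis_flip (x : axis) : axis :=
  match x with axI => axI | axJ => axK | axK => axJ end.

(** Conjugating by the I-reflection fixes the I-reflection and exchanges the other two, as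
    [axis_flip] records. *)
Lemma sym_axes_reflectI (R : realType) (n : nat) (X : tilealg R n) :
  sym_axes (reflect_axis axI X) = axis_flip @^-1: sym_axes X.
Proof.
have E x (w : word n) : wreflect axI (wreflect x w) =
    wreflect (axis_flip x) (wreflect axI w).
  by apply/ffunP => r; rewrite !wreflectE; case: x (w r) => -[].
apply/setP => x; rewrite !inE; apply/symmetricP/symmetricP => H w.
  by have := H (wreflect axI w); rewrite !reflect_axis_coef E wreflectK.
by rewrite !reflect_axis_coef E H.
Qed.

(** * Membership tests at uniform words, at jji...i, and in short or even lengths *)

Lemma even_word2_cword (n : nat) (a b c : digit) : (0 < n)%N -> a != b ->
  even_word2 a b (cword n c) = (c == a) || (c == b) && ~~ odd n.
Proof.
case: n => // n _ ab; rewrite /even_word2.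
have -> : \big[addb/false]_(r < n.+1) (cword n.+1 c r == b) = (c == b) && odd n.+1.
  rewrite (eq_bigr (fun=> c == b)) => [|r _]; last by rewrite ffunE.
  rewrite big_const card_ord; elim: {1 2}n.+1 => [|m IH] /=; first by rewrite andbF.
  by rewrite IH; case: (c == b); case: (odd m).
have -> : [forall r, (cword n.+1 c r == a) || (cword n.+1 c r == b)] =
    (c == a) || (c == b).
  apply/forallP/idP => [/(_ ord0)|H r]; by rewrite ffunE.
case: (c =P a) => [->|_]; first by rewrite (negPf ab).
by case: (c == b).
Qed.

(** For length at least 3 this word uses both i and j, with exactly two j: it occurs in E_ij, and in
    no [Eab] over another pair of distinct digits. *)
Definition jjword (n : nat) : word n := [ffun r : 'I_n => if (r < 2)%N then Dj else Di].

Lemma even_word2_jjword (n : nat) (a b : digit) : (2 < n)%N -> a != b ->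
  even_word2 a b (jjword n) = (a == Di) && (b == Dj) || (a == Dj) && (b == Di) && ~~ odd n.
Proof.
case: n => [|[|[|n]]] // _ ab; rewrite /even_word2.
have -> : [forall r, (jjword n.+3 r == a) || (jjword n.+3 r == b)] =
    ((a == Di) && (b == Dj) || (a == Dj) && (b == Di)).
  apply/forallP/idP => [H|H r].
    (* Position 0 carries j and position 2 carries i, which forces both into the alphabet. *)
    have := H ord0; have := H (inord 2); rewrite !ffunE inordK //=.
    by case: a b ab {H} => -[].
  by rewrite ffunE; case: ifP; case: a b ab H => -[].
rewrite 2!big_ord_recl !ffunE /=.
have -> : \big[addb/false]_(i < n.+1) (jjword n.+3 (lift ord0 (lift ord0 i)) == b)
    = (Di == b) && odd n.+1.
  rewrite (eq_bigr (fun=> Di == b)) => [|r _]; last by rewrite ffunE.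
  rewrite big_const card_ord; elim: {1 2}n.+1 => [|m IH] /=; first by rewrite andbF.
  by rewrite IH; case: (Di == b); case: (odd m).
by case: a b ab => -[] //= _; rewrite /= ?negbK; case: (odd n).
Qed.

Lemma even_word2_len1 (a b : digit) (w : word 1) : a != b ->
  even_word2 a b w = (w ord0 == a).
Proof.
move=> ab; rewrite /even_word2 big_ord1.
have -> : [forall r, (w r == a) || (w r == b)] = (w ord0 == a) || (w ord0 == b).
  by apply/forallP/idP => [|H r]; rewrite ?(ord1 r).
case: (w ord0 =P a) => [->|_]; first by rewrite (negPf ab).
by case: (_ == _).
Qed.

Lemma even_word2_len2 (a b : digit) (w : word 2) : a != b ->
  even_word2 a b w = (w ord0 == w ord_max) && ((w ord0 == a) || (w ord0 == b)).
Proof.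
move=> ab; rewrite /even_word2 big_ord_recl big_ord1.
have -> : lift ord0 (ord0 : 'I_1) = ord_max by apply: val_inj.
have -> : [forall r, (w r == a) || (w r == b)] =
    ((w ord0 == a) || (w ord0 == b)) && ((w ord_max == a) || (w ord_max == b)).
  apply/forallP/idP => [H|/andP[H0 H1] r]; first by rewrite !H.
  by case: (unliftP ord_max r) => [j ->|-> //]; rewrite (_ : lift _ _ = ord0) //;
     apply: val_inj; rewrite /= (ord1 j).
by case: a b ab (w ord0) (w ord_max) => -[] //= _ [] [].
Qed.

Lemma even_word2_sym (n : nat) (a b : digit) (w : word n) : ~~ odd n -> a != b ->
  even_word2 a b w = even_word2 b a w.
Proof.
move=> n_even ab; rewrite /even_word2.
under [in RHS]eq_forallb => r do rewrite orbC.
case: (boolP [forall r, (w r == a) || (w r == b)]) => //= /forallP H.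
congr (~~ _).
(* Each position holds exactly one of [a] and [b], so the two counts add up to [n] and have equal
   parity. *)
suff E : \big[addb/false]_(r < n) (w r == b) (+)
         \big[addb/false]_(r < n) (w r == a) = false.
  by move: E; case: (\big[_/_]_(_ < n) _); case: (\big[_/_]_(_ < n) _).
rewrite -big_split (eq_bigr (fun=> true)) => [|r _] /=.
  rewrite -[RHS](negPf n_even) big_const card_ord.
  by elim: n {w n_even H} => //= n ->.
by case/orP: (H r) => /eqP ->; rewrite eqxx ?(negPf ab) // eq_sym (negPf ab).
Qed.

(** * Symmetry axes of the family E_ij + c E_ek *)

Definition Epair {R : realType} {n : nat} (c : R) : tilealg R n :=
  Eab R n Di Dj + c *: Eab R n De Dk.

Lemma Epair_coef (R : realType) (n : nat) (c : R) (w : word n) :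
  Epair c w = (even_word2 Di Dj w)%:R + c * (even_word2 De Dk w)%:R.
Proof. by rewrite !ffunE !Eab_coef. Qed.

Lemma reflect_Epair_coef (R : realType) (n : nat) (x : axis) (c : R) (w : word n) :
  reflect_axis x (Epair c) w =
  (even_word2 (axis_swap x Di) (axis_swap x Dj) w)%:R
  + c * (even_word2 (axis_swap x De) (axis_swap x Dk) w)%:R.
Proof. by rewrite /Epair linearD linearZ /= !reflect_Eab !ffunE !Eab_coef. Qed.

Lemma Epair_asym (R : realType) (n : nat) (x : axis) (c : R) (w : word n) :
  (even_word2 (axis_swap x Di) (axis_swap x Dj) w)%:R
  + c * (even_word2 (axis_swap x De) (axis_swap x Dk) w)%:R
  != (even_word2 Di Dj w)%:R + c * (even_word2 De Dk w)%:R :> R ->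
  x \notin sym_axes (@Epair R n c).
Proof.
rewrite -reflect_Epair_coef -Epair_coef inE /symmetric_about.
by apply: contra => /eqP ->.
Qed.

Lemma Epair_sym (R : realType) (n : nat) (x : axis) (c : R) :
  (forall w : word n, (even_word2 (axis_swap x Di) (axis_swap x Dj) w)%:R
    + c * (even_word2 (axis_swap x De) (axis_swap x Dk) w)%:R
    = (even_word2 Di Dj w)%:R + c * (even_word2 De Dk w)%:R :> R) ->
  x \in sym_axes (@Epair R n c).
Proof.
move=> H; rewrite inE; apply/eqP/ffunP => w.
by rewrite reflect_Epair_coef H Epair_coef.
Qed.

(** The K-reflection fixes E_ek and sends E_ij to E_ji. These two agree in even length; in odd
    length the uniform i-word lies only in E_ij. *)
Lemma axisK_Epair (R : realType) (n : nat) (c : R) : (0 < n)%N ->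
  (axK \in sym_axes (@Epair R n c)) = ~~ odd n.
Proof.
move=> n_gt0; have [n_odd|n_even] := boolP (odd n).
  apply: negbTE; apply: (@Epair_asym _ _ _ _ (cword n Di)).
  by rewrite /= !even_word2_cword // n_odd /= mulr0 !addr0 eq_sym oner_eq0.
by apply: Epair_sym => w /=; rewrite even_word2_sym.
Qed.

(** The reflected element is E_ik + c E_ej, with coefficient 0 at [jjword] against 1 before
    reflection, for any [c]. *)
Lemma axisI_Epair_ge3 (R : realType) (n : nat) (c : R) : (2 < n)%N ->
  axI \notin sym_axes (@Epair R n c).
Proof.
move=> n_gt2; apply: (@Epair_asym _ _ _ _ (jjword n)).
by rewrite /= !even_word2_jjword //= mulr0 !addr0 eq_sym oner_eq0.
Qed.

Lemma axisJ_Epair_ge3 (R : realType) (n : nat) (c : R) : (2 < n)%N ->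
  axJ \notin sym_axes (@Epair R n c).
Proof.
move=> n_gt2; apply: (@Epair_asym _ _ _ _ (jjword n)).
by rewrite /= !even_word2_jjword //= mulr0 !addr0 eq_sym oner_eq0.
Qed.

(** In length 1 the element is i + c e. *)
Lemma sym_axes_Epair1 (R : realType) (c : R) :
  sym_axes (@Epair R 1 c) = [set axI].
Proof.
apply/setP => -[]; rewrite in_set1 ?axisK_Epair //=.
- by apply: Epair_sym => w; rewrite !even_word2_len1.
- apply: negbTE; apply: (@Epair_asym _ _ _ _ (cword 1 Di)).
  by rewrite !even_word2_len1 // ffunE /= mulr0 !addr0 eq_sym oner_eq0.
Qed.

(** In length 2 the element is ii + jj + c(ee + kk). The I-reflection puts [c] in place of 1 at jj,
    and the J-reflection does so at ii. *)
Lemma sym_axes_Epair2 (R : realType) (c : R) : c != 1 ->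
  sym_axes (@Epair R 2 c) = [set axK].
Proof.
move=> c1; apply/setP => -[]; rewrite in_set1 ?axisK_Epair //=.
- apply: negbTE; apply: (@Epair_asym _ _ _ _ (cword 2 Dj)).
  by rewrite !even_word2_len2 // !ffunE /= mulr0 mulr1 addr0 add0r.
- apply: negbTE; apply: (@Epair_asym _ _ _ _ (cword 2 Di)).
  by rewrite !even_word2_len2 // !ffunE /= mulr0 mulr1 addr0 add0r.
Qed.

(** Here the element is ee + ii + jj + kk, invariant under every permutation of i, j, k. *)
Lemma sym_axes_Epair2_1 (R : realType) :
  sym_axes (@Epair R 2 1) = [set axI; axJ; axK].
Proof.
apply/setP => x; have -> : x \in [set axI; axJ; axK] by rewrite !inE; case: x.
apply: Epair_sym => w; rewrite !even_word2_len2; try by case: x.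
by case: (w ord0 == w ord_max); case: (w ord0); case: x;
  rewrite /= ?mul1r ?mulr0 ?addr0 ?add0r.
Qed.

Lemma sym_axes_Epair_even (R : realType) (n : nat) (c : R) :
  (4 <= n)%N -> ~~ odd n -> sym_axes (@Epair R n c) = [set axK].
Proof.
move=> n_ge4 n_even; have n_gt2 : (2 < n)%N by apply: ltnW.
apply/setP => -[]; rewrite in_set1 ?axisK_Epair ?n_even //=.
- exact: (negbTE (axisI_Epair_ge3 _ _ _ _)).
- exact: (negbTE (axisJ_Epair_ge3 _ _ _ _)).
- by apply: leq_trans n_gt2.
Qed.

Lemma sym_axes_Epair_odd (R : realType) (n : nat) (c : R) :
  (3 <= n)%N -> odd n -> sym_axes (@Epair R n c) = set0.
Proof.
move=> n_gt2 n_odd.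
apply/setP => -[]; rewrite in_set0 ?axisK_Epair ?n_odd //=.
- exact: (negbTE (axisI_Epair_ge3 _ _ _ _)).
- exact: (negbTE (axisJ_Epair_ge3 _ _ _ _)).
- by apply: leq_trans n_gt2.
Qed.

(** * Transfer to the reverse products and conclusion *)

Lemma axis_flip_preim1 (x : axis) : axis_flip @^-1: [set x] = [set axis_flip x].
Proof. by apply/setP => y; rewrite !inE; case: x y => -[]. Qed.

Lemma axis_flip_preim_all :
  axis_flip @^-1: [set axI; axJ; axK] = [set axI; axJ; axK].
Proof. by apply/setP => -[]; rewrite !inE. Qed.

Theorem mainTheorem15 (R : realType) (n : nat) (hn : (1 <= n)%N) :
  let iota_n : word n := cword n Di in
  let I : tilealg R n := Isum R n in
  let Cm : tilealg R n := Sigma_minus R iota_n in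
  let Cp : tilealg R n := Sigma_plus R iota_n in
  let Cb : tilealg R n := Sigma_tiles R iota_n in
  let E : digit -> digit -> tilealg R n := Eab R n in
  [/\ symmetric_about axI I, symmetric_about axI Cm,
      symmetric_about axI Cp & symmetric_about axI Cb]
  /\ [/\ Cm * I = 2 ^+ n.-1 *: (E Di Dj - E De Dk),
         Cp * I = 2 ^+ n.-1 *: (E Di Dj + E De Dk) &
         Cb * I = 2 ^+ n *: E Di Dj]
  /\ [/\ I * Cm = 2 ^+ n.-1 *: (E Di Dk - E De Dj),
         I * Cp = 2 ^+ n.-1 *: (E Di Dk + E De Dj) &
         I * Cb = 2 ^+ n *: E Di Dk]
  /\ [/\ n = 1%N ->
           [/\ sym_axes (Cm * I) = [set axI],
               sym_axes (Cp * I) = [set axI] &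
               sym_axes (Cb * I) = [set axI]],
         n = 2%N ->
           [/\ sym_axes (Cm * I) = [set axK],
               sym_axes (Cb * I) = [set axK] &
               sym_axes (Cp * I) = [set axI; axJ; axK]],
         (4 <= n)%N -> ~~ odd n ->
           [/\ sym_axes (Cm * I) = [set axK],
               sym_axes (Cp * I) = [set axK] &
               sym_axes (Cb * I) = [set axK]] &
         (3 <= n)%N -> odd n ->
           [/\ sym_axes (Cm * I) = set0,
               sym_axes (Cp * I) = set0 &
               sym_axes (Cb * I) = set0]]
  /\ [/\ n = 1%N ->
           [/\ sym_axes (I * Cm) = [set axI],
               sym_axes (I * Cp) = [set axI] &
               sym_axes (I * Cb) = [set axI]],
         n = 2%N ->
           [/\ sym_axes (I * Cm) = [set axJ],
               sym_axes (I * Cb) = [set axJ] &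
               sym_axes (I * Cp) = [set axI; axJ; axK]],
         (4 <= n)%N -> ~~ odd n ->
           [/\ sym_axes (I * Cm) = [set axJ],
               sym_axes (I * Cp) = [set axJ] &
               sym_axes (I * Cb) = [set axJ]] &
         (3 <= n)%N -> odd n ->
           [/\ sym_axes (I * Cm) = set0,
               sym_axes (I * Cp) = set0 &
               sym_axes (I * Cb) = set0]].
Proof.
move=> iota_n I Cm Cp Cb E.
have EP : Cp * I = 2 ^+ n.-1 *: Epair 1.
  by rewrite /Epair scale1r; apply: Sigma_plus_mulI.
have EM : Cm * I = 2 ^+ n.-1 *: Epair (-1).
  by rewrite /Epair scaleN1r; apply: Sigma_minus_mulI.
have EB : Cb * I = 2 ^+ n *: Epair 0.
  by rewrite /Epair scale0r addr0; apply: Sigma_tiles_mulI.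
have rI : reflect_axis axI I = I by exact: reflect_Isum.
have rM : reflect_axis axI Cm = Cm by exact: reflect_Sigma_minus.
have rP : reflect_axis axI Cp = Cp by exact: reflect_Sigma_plus.
have rB : reflect_axis axI Cb = Cb by exact: reflect_Sigma_tiles.
have rev C : reflect_axis axI C = C -> I * C = reflect_axis axI (C * I).
  by move=> rC; rewrite reflect_axisM rC rI.
have c_neq0 m : 2 ^+ m != 0 :> R by rewrite expf_neq0 // pnatr_eq0.
have sP : sym_axes (Cp * I) = sym_axes (@Epair R n 1) by rewrite EP sym_axesZ.
have sM : sym_axes (Cm * I) = sym_axes (@Epair R n (-1)) by rewrite EM sym_axesZ.
have sB : sym_axes (Cb * I) = sym_axes (@Epair R n 0) by rewrite EB sym_axesZ.
(* The values -1 and 0 of [c], for [Cm] and [Cb], must differ from the exceptional value 1 in length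
   2. *)
have N1 : -1 != 1 :> R.
  by rewrite -subr_eq0 -opprD oppr_eq0 -mulr2n pnatr_eq0.
have Z1 : 0 != 1 :> R by rewrite eq_sym oner_eq0.
split; first by split; apply/eqP.
split; first by rewrite EM EP EB /Epair scaleN1r scale1r scale0r addr0.
(* The I-reflection turns E_ij into E_ik and E_ek into E_ej, which yields all three reverse
   formulas. *)
have rE m c : reflect_axis axI (2 ^+ m *: @Epair R n c) =
    2 ^+ m *: (E Di Dk + c *: E De Dj).
  by rewrite linearZ /= /Epair linearD /= linearZ /= !reflect_Eab.
split.
  by rewrite !rev // EM EP EB !rE scaleN1r scale1r scale0r addr0.
have rs C : reflect_axis axI C = C ->
    sym_axes (I * C) = axis_flip @^-1: sym_axes (C * I).
  by move=> rC; rewrite rev // sym_axes_reflectI.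
rewrite !rs // sM sP sB {rE EM EP EB rev rs sM sP sB rI rM rP rB}.
split; split.
- by move=> {E I Cm Cp Cb iota_n hn} ->; rewrite !sym_axes_Epair1.
- move=> {E I Cm Cp Cb iota_n hn} ->.
  by rewrite sym_axes_Epair2_1 !sym_axes_Epair2 //.
- by move=> n4 ne; rewrite !sym_axes_Epair_even.
- by move=> n3 no; rewrite !sym_axes_Epair_odd.
- move=> {E I Cm Cp Cb iota_n hn} ->.
  by rewrite !sym_axes_Epair1 axis_flip_preim1.
- move=> {E I Cm Cp Cb iota_n hn} ->.
  by rewrite sym_axes_Epair2_1 !sym_axes_Epair2 // axis_flip_preim1
    axis_flip_preim_all.
- by move=> n4 ne; rewrite !sym_axes_Epair_even // axis_flip_preim1.
- by move=> n3 no; rewrite !sym_axes_Epair_odd // preimset0.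
Qed.
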